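(* Let $q$ be a prime power, let $\alpha_1,\dots,\alpha_n\in\mathbb{F}_q$ be distinct, let $\delta\in\mathbb{F}_q$, and let $k,r$ be integers with $2\le r\le k-1$ and $k<n$. Put $b=\delta-\sum_{i=1}^n\alpha_i$. Let $H_2$ be the $(n-k+2)\times(n+2)$ matrix whose rows are, in order, $$(u_1\alpha_1^{e},u_2\alpha_2^{e},\dots,u_n\alpha_n^{e},0,0),\qquad e=0,1,\dots,n-k-2,$$ $$(u_1\Lambda_{r,1},u_2\Lambda_{r,2},\dots,u_n\Lambda_{r,n},0,0),$$ $$(u_1\alpha_1^{n-k-1},u_2\alpha_2^{n-k-1},\dots,u_n\alpha_n^{n-k-1},-1,0),$$ $$(u_1\alpha_1^{n-k},u_2\alpha_2^{n-k},\dots,u_n\alpha_n^{n-k},b,-1).$$ Then $H_2$ is a parity check matrix for the code $C_2$ generated by $G_2$.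
   Context: For distinct $\alpha_1,\dots,\alpha_n\in\mathbb{F}_q$ and $1\le r\le k-1$, $G_{r,k}$ is the $k\times n$ matrix whose rows are $(\alpha_1^e,\alpha_2^e,\dots,\alpha_n^e)$ for $e=0,1,\dots,k-r-1,k-r+1,\dots,k$ in this order (all exponents from $0$ to $k$ except $k-r$; convention $0^0=1$). For $\delta\in\mathbb{F}_q$, $G_2$ is the $k\times(n+2)$ matrix obtained by appending to $G_{r,k}$ the two columns $(0,\dots,0,0,1)^T$ and $(0,\dots,0,1,\delta)^T$, in this order, and $C_2$ is the linear code over $\mathbb{F}_q$ generated by $G_2$. Notation: $u_i=\prod_{1\le j\le n,\ j\ne i}(\alpha_i-\alpha_j)^{-1}$ for $1\le i\le n$; $\sigma_t=\sum_{1\le j_1<\dots<j_t\le n}\alpha_{j_1}\cdots\alpha_{j_t}$ is the $t$-th elementary symmetric function of $\alpha_1,\dots,\alpha_n$, with $\sigma_0=1$; and $$\Lambda_{r,i}=\sum_{j=0}^r(-1)^j\sigma_j\,\alpha_i^{(n-k)+(r-1)-j}.$$ A parity check matrix of an $[N,k]$ code $C$ is an $(N-k)\times N$ matrix with linearly independent rows whose row space is the dual code $C^\perp$ (with respect to the standard bilinear form). *)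

(* Defs.v *)
From HB Require Import structures.
From mathcomp Require Import all_boot all_order all_algebra.
From mathcomp Require Import mpoly.

Set Implicit Arguments.
Unset Strict Implicit.
Unset Printing Implicit Defensive.

Import GRing.Theory.
Local Open Scope ring_scope.

Definition code_of (F : fieldType) (m N : nat) (A : 'M[F]_(m, N)) :
  {vspace 'rV[F]_N} := <<[seq row i A | i : 'I_m]>>%VS.

Definition dual_code (F : finFieldType) (N : nat) (C : {vspace 'rV[F]_N}) :
  {vspace 'rV[F]_N} :=
  (\bigcap_(c : 'rV[F]_N | c \in C) lker (linfun (mulmxr c^T)))%VS.

Lemma dual_codeP (F : finFieldType) (N : nat) (C : {vspace 'rV[F]_N})
    (v : 'rV[F]_N) :
  reflect (forall c, c \in C -> \sum_j v 0 j * c 0 j = 0) (v \in dual_code C).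
Proof.
have dotE (c : 'rV[F]_N) :
    (v \in lker (linfun (mulmxr c^T))) = (\sum_j v 0 j * c 0 j == 0).
  rewrite memv_ker lfunE /=.
  have -> : \sum_j v 0 j * c 0 j = (v *m c^T) 0 0.
    by rewrite mxE; apply: eq_bigr => j _; rewrite mxE.
  apply/eqP/eqP => [-> | v0]; first by rewrite mxE.
  by apply/matrixP => i j; rewrite !ord1 v0 mxE.
rewrite memvE; apply: (iffP subv_bigcapP) => h c /h.
  by rewrite -memvE dotE => /eqP.
by move=> v0; rewrite -memvE dotE v0.
Qed.

Definition parity_check_matrix (F : finFieldType) (m N : nat)
    (C : {vspace 'rV[F]_N}) (H : 'M[F]_(m, N)) : Prop :=
  [/\ m = (N - \dim C)%N, row_free H & code_of H = dual_code C].

(* [bump h i] is [i] if [i < h] and [i.+1] otherwise, so the exponents run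
   through 0, ..., k with k - r skipped. *)
Definition Grk (F : fieldType) (n k r : nat) (alpha : 'I_n -> F) :
  'M[F]_(k, n) :=
  \matrix_(i < k, j < n) alpha j ^+ bump (k - r) i.

Definition G2 (F : fieldType) (n k r : nat) (alpha : 'I_n -> F) (delta : F) :
  'M[F]_(k, n + 2) :=
  row_mx (Grk k r alpha)
    (row_mx
      (\col_(i < k) if i.+1 == k then 1 else 0)
      (\col_(i < k) if i.+1 == k then delta
                    else if i.+2 == k then 1 else 0)).

Definition C2 (F : fieldType) (n k r : nat) (alpha : 'I_n -> F) (delta : F) :
  {vspace 'rV[F]_(n + 2)} := code_of (G2 k r alpha delta).

Definition u (F : fieldType) (n : nat) (alpha : 'I_n -> F) (i : 'I_n) : F :=
  \prod_(j < n | j != i) (alpha i - alpha j)^-1.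

Definition sigma (F : fieldType) (n : nat) (alpha : 'I_n -> F) (t : nat) : F :=
  (mesym n F t).@[alpha].

(* The exponent is only used for r >= 1, k < n and j <= r, where none of the
   truncated subtractions on nat truncates. *)
Definition Lambda (F : fieldType) (n k r : nat) (alpha : 'I_n -> F)
    (i : 'I_n) : F :=
  \sum_(0 <= j < r.+1)
    (-1) ^+ j * sigma alpha j * alpha i ^+ ((n - k) + (r - 1) - j).

Definition extend_row (F : fieldType) (n : nat) (f : 'I_n -> F) (x y : F) :
  'rV[F]_(n + 2) :=
  row_mx (\row_(j < n) f j) (row_mx x%:M y%:M).

Definition H2 (F : fieldType) (n k r : nat) (alpha : 'I_n -> F) (delta : F) :
  'M[F]_(n - k + 2, n + 2) :=
  let b := delta - \sum_(i < n) alpha i in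
  \matrix_(i < n - k + 2)
    if (i < n - k - 1)%N then
      extend_row (fun j => u alpha j * alpha j ^+ i) 0 0
    else if i == (n - k - 1)%N :> nat then
      extend_row (fun j => u alpha j * Lambda k r alpha j) 0 0
    else if i == (n - k)%N :> nat then
      extend_row (fun j => u alpha j * alpha j ^+ (n - k - 1)) (-1) 0
    else
      extend_row (fun j => u alpha j * alpha j ^+ (n - k)) b (-1).

(* Main.v *)
(* If H G^T = 0, both matrices have linearly independent rows and their row
   counts add up to the length, then H is a parity check matrix of the code
   generated by G. The first n entries of each row of H2 are u_i h(alpha_i) for
   a polynomial h, and Lagrange interpolation gives
   sum_i u_i p(alpha_i) = coefficient of X^(n-1) in p when deg p < n. Each inner
   product thus becomes a coefficient, after reduction modulo
   P = prod_i (X - alpha_i) when the degree reaches n: X^n reduces to degree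
   below n with leading term (sum_i alpha_i) X^(n-1), and Lambda_r is the r-th
   truncation of P, shifted. Linear independence of the rows holds because a
   polynomial of degree below n vanishing at all the alpha_i is zero. *)
Require Import Defs.
From mathcomp Require Import all_boot all_order all_algebra zify.
From mathcomp Require Import mpoly.

Set Implicit Arguments.
Unset Strict Implicit.
Unset Printing Implicit Defensive.

Import GRing.Theory.
Local Open Scope ring_scope.

(** * Codes as row spaces, and their duals *)

Lemma mem_code_of (F : fieldType) (m N : nat) (A : 'M[F]_(m, N))
    (v : 'rV[F]_N) :
  (v \in code_of A) = (v <= A)%MS.
Proof.
apply/idP/idP => [vA | /submxP [c ->]].
  (* The row space of [A] is the kernel of multiplication by [cokermx A], so it is enough to check
     the spanning rows. *)
  suff sub : (code_of A <= lker (linfun (mulmxr (cokermx A))))%VS.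
    by move: (subvP sub _ vA); rewrite memv_ker lfunE /= submxE.
  apply/span_subvP => _ /mapP [i _ ->].
  by rewrite memv_ker lfunE /= -submxE row_sub.
rewrite mulmx_sum_row; apply: memv_suml => i _; apply: memvZ; apply: memv_span.
by apply: map_f; rewrite mem_enum.
Qed.

Lemma dim_code_of (F : fieldType) (m N : nat) (A : 'M[F]_(m, N)) :
  row_free A -> \dim (code_of A) = m.
Proof.
move=> freeA; set X := [tuple row i A | i < m].
have codeE : code_of A = <<X>>%VS by [].
suff /eqP -> : free X by rewrite size_tuple.
apply/freeP => c c0 i.
have : \row_i c i *m A = 0.
  rewrite mulmx_sum_row -[RHS]c0; apply: eq_bigr => j _.
  by rewrite mxE (nth_map j) ?size_enum_ord // nth_ord_enum.
move/eqP; rewrite mulmx_free_eq0 // => /eqP /rowP /(_ i).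
by rewrite !mxE.
Qed.

Lemma mem_dual_code_of (F : finFieldType) (m N : nat) (A : 'M[F]_(m, N))
    (v : 'rV[F]_N) :
  (v \in dual_code (code_of A)) = (v <= kermx A^T)%MS.
Proof.
have dotE (c : 'rV[F]_N) : \sum_j v 0 j * c 0 j = (v *m c^T) 0 0.
  by rewrite mxE; apply: eq_bigr => j _; rewrite mxE.
apply/dual_codeP/sub_kermxP => [vA | vA c].
  apply/rowP => i; have := vA (row i A).
  rewrite mem_code_of row_sub => /(_ isT).
  by rewrite !mxE; apply: etrans; apply: eq_bigr => j _; rewrite !mxE.
rewrite mem_code_of => /submxP [d ->].
by rewrite dotE trmx_mul mulmxA vA mul0mx mxE.
Qed.

Lemma parity_check_matrix_code_of (F : finFieldType) (m k N : nat)
    (G : 'M[F]_(k, N)) (H : 'M[F]_(m, N)) :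
  row_free G -> row_free H -> m = (N - k)%N -> H *m G^T = 0 ->
  parity_check_matrix (code_of G) H.
Proof.
move=> freeG freeH mE HG0; split; rewrite ?dim_code_of //.
apply/vspaceP => v; rewrite mem_code_of mem_dual_code_of.
have sHK : (H <= kermx G^T)%MS by apply/sub_kermxP.
have /eqmxP -> // : (H == kermx G^T)%MS.
(* An inclusion of row spaces of equal rank is an equality; both ranks are [N - k]. *)
rewrite -(mxrank_leqif_eq sHK) mxrank_ker mxrank_tr.
by rewrite (eqP freeG) (eqP freeH) mE.
Qed.

(** * Interpolation at the nodes and sums weighted by [u] *)

Lemma poly_eq0_of_roots (F : fieldType) (n : nat) (alpha : 'I_n -> F)
    (p : {poly F}) :
  injective alpha -> (size p <= n)%N -> (forall i, p.[alpha i] = 0) -> p = 0.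
Proof.
move=> alpha_inj szp p0.
apply: (@roots_geq_poly_eq0 _ _ [seq alpha i | i <- enum 'I_n]).
- by apply/allP => _ /mapP [i _ ->]; apply/eqP.
- by rewrite map_inj_uniq ?enum_uniq.
- by rewrite size_map size_enum_ord.
Qed.

Lemma u_neq0 (F : fieldType) (n : nat) (alpha : 'I_n -> F) (i : 'I_n) :
  injective alpha -> u alpha i != 0.
Proof.
move=> alpha_inj; apply/prodf_neq0 => j ne_ji.
by rewrite invr_eq0 subr_eq0 eq_sym (inj_eq alpha_inj).
Qed.

Definition node_poly (F : fieldType) (n : nat) (alpha : 'I_n -> F) : {poly F} :=
  \prod_(i < n) ('X - (alpha i)%:P).

Lemma size_node_poly (F : fieldType) (n : nat) (alpha : 'I_n -> F) :
  size (node_poly alpha) = n.+1.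
Proof. by rewrite /node_poly -big_enum size_prod_XsubC size_enum_ord. Qed.

Lemma coef_node_poly (F : fieldType) (n : nat) (alpha : 'I_n -> F) (t : nat) :
  (t <= n)%N -> (node_poly alpha)`_(n - t) = (-1) ^+ t * sigma alpha t.
Proof.
move=> le_tn.
have := @mroots_coeff F n [tuple alpha i | i < n]
  (Ordinal (le_tn : (t < n.+1)%N)).
rewrite big_map big_enum /= => ->; congr (_ * _); apply: meval_eq => i.
by rewrite tnth_mktuple.
Qed.

Lemma horner_node_poly (F : fieldType) (n : nat) (alpha : 'I_n -> F)
    (i : 'I_n) :
  (node_poly alpha).[alpha i] = 0.
Proof. by rewrite horner_prod (bigD1 i) //= !hornerE subrr mul0r. Qed.

(* Lagrange interpolation of [p] at the nodes, read off in degree [n.-1]. *)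
Lemma sum_u_horner (F : fieldType) (n : nat) (alpha : 'I_n -> F)
    (p : {poly F}) :
  injective alpha -> (size p <= n)%N ->
  \sum_i u alpha i * p.[alpha i] = p`_n.-1.
Proof.
move=> alpha_inj szp.
pose Q i : {poly F} := \prod_(j < n | j != i) ('X - (alpha j)%:P).
have monQ i : Q i \is monic by apply: monic_prod_XsubC.
have szQ i : size (Q i) = n.
  have := size_node_poly alpha; rewrite /node_poly (bigD1 i) //= -/(Q i).
  by rewrite size_Mmonic ?polyXsubC_eq0 // size_XsubC => -[].
(* Lagrange formula: [Q i] vanishes at the other nodes, and its value at [alpha i] is the inverse of
   [u alpha i]. *)
have pE : p = \sum_i (u alpha i * p.[alpha i]) *: Q i.
  apply/eqP; rewrite -subr_eq0; apply/eqP; apply: (poly_eq0_of_roots alpha_inj).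
    rewrite (leq_trans (size_polyD _ _)) // size_polyN geq_max szp.
    apply: leq_trans (size_sum _ _ _) _; apply/bigmax_leqP => i _.
    by rewrite (leq_trans (size_scale_leq _ _)) ?szQ.
  move=> j; rewrite hornerD hornerN horner_sum (bigD1 j) //= big1 => [|i ne_ij].
    rewrite addr0 hornerZ horner_prod mulrAC /u -big_split.
    rewrite big1 ?mul1r ?subrr //=.
    move=> i ne_ij; rewrite !hornerE mulVf // subr_eq0.
    by apply: contra ne_ij => /eqP /alpha_inj ->.
  rewrite hornerZ /Q (bigD1 j) 1?eq_sym //= hornerM hornerXsubC subrr.
  by rewrite mul0r mulr0.
rewrite [in RHS]pE coef_sum; apply: eq_bigr => i _.
(* Degree [n.-1] is the leading degree of the monic [Q i]. *)
rewrite coefZ -[X in X.-1](szQ i) -lead_coefE (monicP (monQ i)).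
by rewrite mulr1.
Qed.

(* The Viete coefficients of [node_poly] make this the polynomial whose value at
   [alpha i] is [Lambda]; multiplied by 'X^(k - r).+1, it is [node_poly] up to
   terms of degree less than n - r. *)
Definition Lambda_poly (F : fieldType) (n k r : nat) (alpha : 'I_n -> F) :
  {poly F} := drop_poly (n - r) (node_poly alpha) * 'X^(n - k - 1).

Lemma size_Lambda_poly (F : fieldType) (n k r : nat) (alpha : 'I_n -> F) :
  (0 < r <= k)%N -> (k < n)%N -> size (Lambda_poly k r alpha) = (n - k + r)%N.
Proof.
move=> hr hk; rewrite size_mulXn ?size_drop_poly ?size_node_poly; first lia.
by rewrite -size_poly_gt0 size_drop_poly size_node_poly; lia.
Qed.

Lemma LambdaE (F : fieldType) (n k r : nat) (alpha : 'I_n -> F) (i : 'I_n) :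
  (0 < r <= k)%N -> (k < n)%N ->
  Lambda k r alpha i = (Lambda_poly k r alpha).[alpha i].
Proof.
move=> hr hk; rewrite hornerM hornerXn (@horner_coef_wide _ r.+1); last first.
  by rewrite size_drop_poly size_node_poly; lia.
(* [Lambda] runs from the top coefficient down, Horner evaluation from the bottom up. *)
rewrite mulr_suml /Lambda big_mkord (reindex_inj rev_ord_inj).
apply: eq_bigr => j _; have := ltn_ord j => hj.
rewrite -coef_node_poly /=; last lia.
rewrite coef_drop_poly -mulrA -exprD; congr (_`_ _ * _ ^+ _); lia.
Qed.

(** This is the shape of the inner product, on the first [n] coordinates, of a row of [H2] with the
    row of exponent [e] of [G2]. *)
Lemma sum_u_horner_exp (F : fieldType) (n : nat) (alpha : 'I_n -> F)
    (p : {poly F}) (e : nat) :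
  injective alpha -> (size p + e <= n)%N -> (e < n)%N ->
  \sum_i u alpha i * p.[alpha i] * alpha i ^+ e = p`_(n.-1 - e).
Proof.
move=> alpha_inj szp lt_en.
have szpX : (size (p * 'X^e)%R <= n)%N.
  by rewrite (leq_trans (size_polyMleq _ _)) // size_polyXn; lia.
have := sum_u_horner alpha_inj szpX; rewrite coefMXn ifN; last lia.
move=> <-; apply: eq_bigr => i _.
by rewrite hornerM hornerXn mulrA.
Qed.

Lemma sum_u_exp_card (F : fieldType) (n : nat) (alpha : 'I_n -> F) :
  injective alpha -> (0 < n)%N ->
  \sum_i u alpha i * alpha i ^+ n = \sum_i alpha i.
Proof.
(* [p] is the remainder of [X^n] modulo the monic [node_poly], so it agrees with [X^n] at the
   nodes. *)
move=> alpha_inj n_gt0; pose p := 'X^n - node_poly alpha.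
have lead1 : (node_poly alpha)`_n = 1.
  have /monicP := monic_prod_XsubC (index_enum 'I_n) xpredT alpha.
  by rewrite lead_coefE -/(node_poly alpha) size_node_poly.
have szp : (size p <= n)%N.
  apply/leq_sizeP => j le_nj; rewrite coefB coefXn.
  case: eqP => [-> | ne_jn]; first by rewrite lead1 subrr.
  by rewrite nth_default ?subr0 // size_node_poly; lia.
have := sum_u_horner alpha_inj szp.
have -> : p`_n.-1 = \sum_i alpha i.
  rewrite coefB coefXn (_ : n.-1 == n = false); last lia.
  rewrite -subn1 coef_node_poly // /sigma mesym1E raddf_sum /= expr1.
  rewrite mulN1r sub0r opprK.
  by apply: eq_bigr => i _; rewrite mevalXU.
move=> <-; apply: eq_bigr => i _.
by rewrite hornerD hornerN horner_node_poly subr0 hornerXn.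
Qed.

(** Below [k - r] the product has degree less than [n - 1]; above it, reduction modulo [node_poly]
    brings the degree below [n - 1]. At the gap [k - r] itself, the leading coefficient 1 would
    survive. *)
Lemma sum_u_Lambda (F : fieldType) (n k r e : nat) (alpha : 'I_n -> F) :
  injective alpha -> (0 < r <= k)%N -> (k < n)%N -> (e <= k)%N ->
  e != (k - r)%N ->
  \sum_i u alpha i * (Lambda_poly k r alpha).[alpha i] * alpha i ^+ e = 0.
Proof.
move=> alpha_inj hr hk le_ek ne_e.
have [lt_e | ge_e] := ltnP e (k - r).
  rewrite sum_u_horner_exp ?size_Lambda_poly //; try lia.
  by rewrite nth_default // size_Lambda_poly //; lia.
(* At the nodes, the high part of [node_poly] equals minus its low part, which uses up [(k - r).+1]
   of the factors [alpha i]. *)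
pose p : {poly F} := - take_poly (n - r) (node_poly alpha).
have szp : (size p <= n - r)%N by rewrite size_polyN size_take_poly.
transitivity (\sum_i u alpha i * p.[alpha i] * alpha i ^+ (e - (k - r).+1)).
  apply: eq_bigr => i _; rewrite -!mulrA; congr (_ * _).
  have := horner_node_poly alpha i.
  rewrite -[X in X.[_]](poly_take_drop (n - r)) hornerD hornerM hornerXn.
  rewrite addrC => /(canRL (addrK _)); rewrite sub0r -hornerN -/p => <-.
  rewrite hornerM hornerXn -!mulrA -!exprD; congr (_ * _ ^+ _); lia.
clearbody p; rewrite sum_u_horner_exp //; [|lia|lia].
by rewrite nth_default // (leq_trans szp) //; lia.
Qed.

(** * The rows of [H2] as polynomials *)

Definition H2_poly (F : fieldType) (n k r : nat) (alpha : 'I_n -> F) (i : nat) :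
  {poly F} :=
  if (i < n - k - 1)%N then 'X^i
  else if i == (n - k - 1)%N then Lambda_poly k r alpha
  else if i == (n - k)%N then 'X^(n - k - 1)
  else 'X^(n - k).

Lemma extend_rowE (F : fieldType) (n : nat) (f : 'I_n -> F) (x y : F)
    (a : 'rV[F]_n) (b c : 'rV[F]_1) :
  (forall j, f j = a 0 j) -> x = b 0 0 -> y = c 0 0 ->
  extend_row f x y = row_mx a (row_mx b c).
Proof.
move=> fE -> ->; rewrite /extend_row -!mx11_scalar; congr row_mx.
by apply/rowP => j; rewrite mxE.
Qed.

(** These column blocks match those of [G2], so [H2 *m G2^T] splits into three sums. *)
Lemma H2E (F : fieldType) (n k r : nat) (alpha : 'I_n -> F) (delta : F) :
  (0 < r <= k)%N -> (k < n)%N ->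
  H2 k r alpha delta =
  row_mx (\matrix_(i, j) (u alpha j * (H2_poly k r alpha i).[alpha j]))
    (row_mx
      (\col_i if i == (n - k)%N :> nat then -1
              else if i == (n - k).+1 :> nat then delta - \sum_j alpha j else 0)
      (\col_i if i == (n - k).+1 :> nat then -1 else 0)).
Proof.
move=> hr hk; apply/row_matrixP => i.
rewrite rowK row_row_mx (@row_row_mx _ _ 1 1).
have hi := ltn_ord i.
have [lt_i | ge_i] := ltnP i (n - k - 1).
  apply: extend_rowE => [j||];
    rewrite !mxE ?ifN /H2_poly ?lt_i ?hornerXn //; lia.
case: eqP => [iE | niE].
  by apply: extend_rowE => [j||];
    rewrite !mxE /H2_poly iE ?ltnn ?eqxx ?LambdaE ?ifN //; lia.
case: eqP => [iE' | niE'].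
  have ltF : (n - k < n - k - 1)%N = false by lia.
  have eqF : (n - k == n - k - 1)%N = false by lia.
  have eqF' : (n - k == (n - k).+1)%N = false by lia.
  by apply: extend_rowE => [j||];
    rewrite !mxE /H2_poly iE' ?ltF ?eqF ?eqF' ?eqxx ?hornerXn.
have iE2 : i = (n - k).+1 :> nat by lia.
have ltF : ((n - k).+1 < n - k - 1)%N = false by lia.
have eqF : ((n - k).+1 == n - k - 1)%N = false by lia.
have eqF' : ((n - k).+1 == n - k)%N = false by lia.
by apply: extend_rowE => [j||];
    rewrite !mxE /H2_poly iE2 ?ltF ?eqF ?eqF' ?eqxx ?hornerXn.
Qed.

(** * Linear independence of the rows *)

Lemma row_free_G2 (F : fieldType) (n k r : nat) (alpha : 'I_n -> F)
    (delta : F) :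
  injective alpha -> (k < n)%N -> row_free (G2 k r alpha delta).
Proof.
move=> alpha_inj hk; apply: inj_row_free => v.
rewrite mul_mx_row -(row_mx0 _ 1 n (1 + 1)) => /eq_row_mx [vG0 _].
(* The first [n] columns say that [p] vanishes at the nodes; its monomials are distinct, of degree
   at most [k < n]. *)
pose p := \sum_(i < k) v 0 i *: 'X^(bump (k - r) i).
have p0 : p = 0.
  apply: (poly_eq0_of_roots alpha_inj) => [|j].
    apply: leq_trans (size_sum _ _ _) _; apply/bigmax_leqP => i _.
    rewrite (leq_trans (size_scale_leq _ _)) // size_polyXn /bump.
    have := ltn_ord i; lia.
  move/rowP/(_ j): vG0; rewrite !mxE => vG0; rewrite -[RHS]vG0 horner_sum.
  by apply: eq_bigr => i _; rewrite hornerZ hornerXn mxE.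
apply/rowP => i; rewrite mxE.
move/(congr1 (fun q : {poly F} => q`_(bump (k - r) i))): p0.
rewrite coef0 coef_sum (bigD1 i) //= big1 => [|j ne_ji].
  by rewrite addr0 coefZ coefXn eqxx mulr1.
by rewrite coefZ coefXn eqn_leq !leq_bump2 -eqn_leq val_eqE eq_sym
  (negPf ne_ji) mulr0.
Qed.

(** Elimination goes from the bottom row up: the two appended columns are triangular and kill the
    last two coefficients, then the degree of [Lambda_poly] isolates its row, and distinct monomials
    remain. *)
Lemma row_free_H2 (F : fieldType) (n k r : nat) (alpha : 'I_n -> F)
    (delta : F) :
  injective alpha -> (0 < r < k)%N -> (k < n)%N ->
  row_free (H2 k r alpha delta).
Proof.
move=> alpha_inj hr hk; apply: inj_row_free => v.
have hr' : (0 < r <= k)%N by lia.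
rewrite H2E //; set b := delta - _.
rewrite mul_mx_row -(row_mx0 _ 1 n (1 + 1)) => /eq_row_mx [vA0].
rewrite (@mul_mx_row _ _ _ 1 1) -(row_mx0 _ 1 1 1).
move=> /(@eq_row_mx _ 1 1 1) [vB0 vC0].
have v_last (i : 'I_(n - k + 2)) : i = (n - k).+1 :> nat -> v 0 i = 0.
  move=> iE; move/rowP/(_ 0): vC0; rewrite !mxE (bigD1 i) //=.
  rewrite big1 => [|j ne_ji].
    by rewrite mxE iE eqxx mulrN1 addr0 => /eqP; rewrite oppr_eq0 => /eqP.
  rewrite mxE ifN ?mulr0 //; apply: contra ne_ji => /eqP jE.
  by apply/eqP/val_inj; rewrite /= jE iE.
have v_prev (i : 'I_(n - k + 2)) : i = (n - k)%N :> nat -> v 0 i = 0.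
  move=> iE; move/rowP/(_ 0): vB0; rewrite !mxE (bigD1 i) //=.
  rewrite big1 => [|j ne_ji].
    by rewrite mxE iE eqxx mulrN1 addr0 => /eqP; rewrite oppr_eq0 => /eqP.
  rewrite mxE ifN; last first.
    by apply: contra ne_ji => /eqP jE; apply/eqP/val_inj; rewrite /= jE iE.
  by case: eqP => [/v_last ->|]; rewrite ?mul0r ?mulr0.
pose p := \sum_i v 0 i *: H2_poly k r alpha i.
have p0 : p = 0.
  apply: (poly_eq0_of_roots alpha_inj) => [|j].
    apply: leq_trans (size_sum _ _ _) _; apply/bigmax_leqP => i _.
    rewrite (leq_trans (size_scale_leq _ _)) // /H2_poly.
    do !case: ifP => ?; rewrite ?size_polyXn ?size_Lambda_poly //; lia.
  apply: (mulfI (u_neq0 j alpha_inj)); rewrite mulr0.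
  move/rowP/(_ j): vA0; rewrite !mxE => vA0; rewrite -[RHS]vA0.
  rewrite horner_sum mulr_sumr.
  by apply: eq_bigr => i _; rewrite hornerZ mxE mulrCA.
have coef_p t : \sum_i v 0 i * (H2_poly k r alpha i)`_t = 0.
  rewrite -[RHS](coef0 F t) -p0 coef_sum; apply: eq_bigr => i _.
  by rewrite coefZ.
(* [(n - k + r).-1] is the degree of [Lambda_poly]; the monomials still present have degree below
   [n - k - 1]. *)
have v_Lambda (i : 'I_(n - k + 2)) : i = (n - k - 1)%N :> nat -> v 0 i = 0.
  move=> iE; have := coef_p (n - k + r).-1.
  rewrite (bigD1 i) //= big1 => [|j ne_ji].
    rewrite /H2_poly iE ltnn eqxx addr0.
    rewrite -(@size_Lambda_poly _ _ _ _ alpha hr' hk).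
    move=> /eqP; rewrite -lead_coefE mulf_eq0 lead_coef_eq0 -size_poly_eq0.
    by rewrite size_Lambda_poly // => /orP [/eqP //|]; lia.
  rewrite /H2_poly.
  case: ltnP => [lt_j|ge_j].
    by rewrite coefXn (_ : (_ == _) = false) ?mulr0 //; lia.
  case: eqP => [jE|njE].
    by case/eqP: ne_ji; apply/val_inj; rewrite /= jE iE.
  case: eqP => [/v_prev -> |njE']; first by rewrite mul0r.
  by rewrite v_last ?mul0r //; have := ltn_ord j; lia.
apply/rowP => i; rewrite mxE; have hi := ltn_ord i.
have [lt_i | ge_i] := ltnP i (n - k - 1); last first.
  have [/v_Lambda|[/v_prev|/v_last]] // :
    i = (n - k - 1)%N :> nat \/ i = (n - k)%N :> nat \/
    i = (n - k).+1 :> nat by lia.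
have := coef_p i; rewrite (bigD1 i) //= big1 => [|j ne_ji].
  by rewrite /H2_poly lt_i coefXn eqxx mulr1 addr0.
have hj := ltn_ord j.
have [lt_j | ge_j] := ltnP j (n - k - 1).
  rewrite /H2_poly lt_j coefXn (_ : (_ == _) = false) ?mulr0 //.
  by rewrite eq_sym; apply: negPf.
suff -> : v 0 j = 0 by rewrite mul0r.
have [/v_Lambda|[/v_prev|/v_last]] // :
  j = (n - k - 1)%N :> nat \/ j = (n - k)%N :> nat \/
  j = (n - k).+1 :> nat by lia.
Qed.

(** * Orthogonality of [H2] and [G2] *)

Lemma H2_mul_G2 (F : fieldType) (n k r : nat) (alpha : 'I_n -> F)
    (delta : F) :
  injective alpha -> (1 < r < k)%N -> (k < n)%N ->
  H2 k r alpha delta *m (G2 k r alpha delta)^T = 0.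
Proof.
move=> alpha_inj hr hk.
have hr' : (0 < r <= k)%N by lia.
rewrite H2E // /G2 tr_row_mx mul_row_col (@tr_row_mx _ _ 1 1).
rewrite (@mul_row_col _ _ 1 1); apply/matrixP => i l.
have := ltn_ord i; have hl := ltn_ord l => hi.
rewrite !mxE !big_ord1 !mxE.
under eq_bigr => j _ do rewrite !mxE.
(* As [r >= 2], the last two rows of [G2] have exponents [k - 1] and [k]; they are the only rows
   with nonzero entries in the appended columns. *)
set e := bump (k - r) l.
have eE : e = (l + (k - r <= l))%N by rewrite addnC.
have le_ek : (e <= k)%N by lia.
have ne_e : e != (k - r)%N by rewrite eq_sym neq_bump.
rewrite /H2_poly; have [lt_i | ge_i] := ltnP i (n - k - 1).
  (* Here [i + e <= n - 2], so the coefficient in degree [n - 1] is zero. *)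
  rewrite sum_u_horner_exp ?size_polyXn //; try lia.
  have -> : (i == n - k :> nat)%N = false by lia.
  have -> : (i == (n - k).+1 :> nat)%N = false by lia.
  by rewrite coefXn (_ : (_ == _) = false) ?mul0r ?addr0 //; lia.
have [iE | niE] := eqVneq (i : nat) (n - k - 1)%N.
  have -> : (i == n - k :> nat)%N = false by lia.
  have -> : (i == (n - k).+1 :> nat)%N = false by lia.
  by rewrite sum_u_Lambda // !mul0r !addr0.
have [iE' | niE'] := eqVneq (i : nat) (n - k)%N.
  rewrite sum_u_horner_exp ?size_polyXn //; try lia.
  have -> : (i == (n - k).+1 :> nat)%N = false by lia.
  rewrite coefXn.
  (* Degree [n - 1] is reached exactly when [e = k], and the entry -1 cancels it. *)
  have [lE | nlE] := eqVneq l.+1 k.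
    by rewrite (_ : (_ == _) = true) ?mulN1r ?mul0r ?addr0 ?subrr //; lia.
  by rewrite (_ : (_ == _) = false) ?mulr0 ?mul0r ?addr0 //; lia.
have iE2 : i = (n - k).+1 :> nat by lia.
rewrite iE2 eqxx; have [lE | nlE] := eqVneq l.+1 k.
  (* The monomial is now [X^n]: the sum of the [alpha i], plus [b], minus [delta], is zero. *)
  have expE : (n - k + e)%N = n by lia.
  under eq_bigr => j _ do rewrite hornerXn -mulrA -exprD expE.
  rewrite sum_u_exp_card //; last lia.
  by rewrite mulr1 mulN1r addrA subrKC subrr.
rewrite mulr0 add0r sum_u_horner_exp ?size_polyXn //; try lia.
rewrite coefXn; have [lE' | nlE'] := eqVneq l.+2 k.
  by rewrite (_ : (_ == _) = true) ?mulN1r ?subrr //; lia.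
by rewrite (_ : (_ == _) = false) ?mulr0 ?addr0 //; lia.
Qed.

Theorem theorem5p1 (F : finFieldType) (n k r : nat) (alpha : 'I_n -> F)
    (delta : F) (alpha_inj : injective alpha)
    (hr : (2 <= r <= k - 1)%N) (hk : (k < n)%N) :
  parity_check_matrix (C2 k r alpha delta) (H2 k r alpha delta).
Proof.
apply: parity_check_matrix_code_of.
- exact: row_free_G2.
- by apply: row_free_H2 => //; lia.
- lia.
- by apply: H2_mul_G2 => //; lia.
Qed.
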